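(* Let $G$ be a Hausdorff topological group. Suppose that $G$ is FSIN, periodic, and a Baire space. Then $G$ is SIN.
   Context: Let $e$ be the unit of $G$ and $\mathcal N(e)$ the set of all neighborhoods of $e$ in $G$. The left uniformity $\mathcal U_l$ of $G$ has as a basis of entourages the sets $\{(x,y)\in G\times G: x^{-1}y\in V\}$, $V\in\mathcal N(e)$; the right uniformity $\mathcal U_r$ has as a basis of entourages the sets $\{(x,y)\in G\times G: xy^{-1}\in V\}$, $V\in\mathcal N(e)$. $G$ is SIN if $\mathcal U_l=\mathcal U_r$. A function $f:G\to\mathbb R$ is left (right) uniformly continuous if it is uniformly continuous when $G$ is equipped with $\mathcal U_l$ (with $\mathcal U_r$) and $\mathbb R$ with its usual metric. $G$ is FSIN if every bounded left uniformly continuous function $f:G\to\mathbb R$ is right uniformly continuous. $G$ is periodic (a torsion group) if every element of $G$ is of finite order. *)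

(* Defs.v *)
From HB Require Import structures.
From mathcomp Require Import all_boot all_order all_algebra.
From mathcomp Require Import all_classical all_reals all_analysis.

Set Implicit Arguments.
Unset Strict Implicit.
Unset Printing Implicit Defensive.

Import numFieldNormedType.Exports.

Local Open Scope classical_set_scope.
Local Open Scope group_scope.

HB.mixin Record isTopologicalGroup G of Topological G & Group G := {
  mulg_continuous : continuous (fun xy : G * G => xy.1 * xy.2);
  invg_continuous : continuous (fun x : G => x^-1)
}.

#[short(type="topologicalGroupType")]
HB.structure Definition TopologicalGroup :=
  {G of Topological G & Group G & isTopologicalGroup G}.

Section Uniformities.
Variable G : topologicalGroupType.

Definition left_entourage : set_system (G * G) :=
  filter_from (nbhs (1 : G)) (fun V => [set xy | V (xy.1^-1 * xy.2)]).

Definition right_entourage : set_system (G * G) :=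
  filter_from (nbhs (1 : G)) (fun V => [set xy | V (xy.1 * xy.2^-1)]).

Lemma nbhs1_inv (V : set G) : nbhs (1 : G) V -> nbhs (1 : G) [set x | V x^-1].
Proof. by move=> V1; apply: (@invg_continuous G 1); rewrite invg1. Qed.

Lemma nbhs1_mul (V : set G) : nbhs (1 : G) V ->
  exists2 W, nbhs (1 : G) W & forall x y, W x -> W y -> V (x * y).
Proof.
move=> V1; have : nbhs ((1, 1) : G * G) [set xy | V (xy.1 * xy.2)].
  by apply: (@mulg_continuous G (1, 1)); rewrite /= mulg1.
case=> -[A B] /= [A1 B1] AB; exists (A `&` B); first exact: filterI.
by move=> x y [Ax _] [_ By]; apply: (AB (x, y)).
Qed.

Lemma nbhs_mull (a x : G) (V : set G) :
  nbhs (a * x) V -> nbhs x [set y | V (a * y)].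
Proof.
move=> aV; have : nbhs ((a, x) : G * G) [set xy | V (xy.1 * xy.2)].
  exact: (@mulg_continuous G (a, x)).
case=> -[A B] /= [/nbhs_singleton Aa Bx] AB.
by apply: filterS Bx => y By; apply: (AB (a, y)).
Qed.

Lemma nbhs_mulr (a x : G) (V : set G) :
  nbhs (x * a) V -> nbhs x [set y | V (y * a)].
Proof.
move=> aV; have : nbhs ((x, a) : G * G) [set xy | V (xy.1 * xy.2)].
  exact: (@mulg_continuous G (x, a)).
case=> -[A B] /= [Ax /nbhs_singleton Ba] AB.
by apply: filterS Ax => y Ay; apply: (AB (y, a)).
Qed.

Lemma left_entourage_filter : Filter left_entourage.
Proof.
apply: filter_from_filter; first by exists setT; exact: filterT.
by move=> V W V1 W1; exists (V `&` W); first exact: filterI.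
Qed.

Lemma right_entourage_filter : Filter right_entourage.
Proof.
apply: filter_from_filter; first by exists setT; exact: filterT.
by move=> V W V1 W1; exists (V `&` W); first exact: filterI.
Qed.

Lemma left_entourage_diagonal A : left_entourage A -> diagonal `<=` A.
Proof.
move=> [V V1 VA] [x y] /= xy; apply: VA => /=.
by rewrite -[y]xy mulVg; exact: nbhs_singleton.
Qed.

Lemma right_entourage_diagonal A : right_entourage A -> diagonal `<=` A.
Proof.
move=> [V V1 VA] [x y] /= xy; apply: VA => /=.
by rewrite -[y]xy mulgV; exact: nbhs_singleton.
Qed.

Lemma left_entourage_inv A : left_entourage A -> left_entourage A^-1%relation.
Proof.
move=> [V V1 VA]; exists [set x | V x^-1]; first exact: nbhs1_inv.
by move=> [x y] /=; rewrite invgM invgK => Vyx; exact: VA.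
Qed.

Lemma right_entourage_inv A : right_entourage A -> right_entourage A^-1%relation.
Proof.
move=> [V V1 VA]; exists [set x | V x^-1]; first exact: nbhs1_inv.
by move=> [x y] /=; rewrite invgM invgK => Vyx; exact: VA.
Qed.

Lemma left_entourage_split A : left_entourage A ->
  exists2 B, left_entourage B & (B \; B `<=` A)%relation.
Proof.
move=> [V /nbhs1_mul[W W1 WV] VA].
exists [set xy | W (xy.1^-1 * xy.2)]; first by exists W.
move=> [x z] [y /= xy yz]; apply: VA => /=.
by have := WV _ _ xy yz; rewrite mulgA mulgK.
Qed.

Lemma right_entourage_split A : right_entourage A ->
  exists2 B, right_entourage B & (B \; B `<=` A)%relation.
Proof.
move=> [V /nbhs1_mul[W W1 WV] VA].
exists [set xy | W (xy.1 * xy.2^-1)]; first by exists W.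
move=> [x z] [y /= xy yz]; apply: VA => /=.
by have := WV _ _ xy yz; rewrite mulgA mulgVK.
Qed.

Lemma left_nbhsE : nbhs = nbhs_ left_entourage.
Proof.
apply/funext => x; apply/seteqP; split=> [A Ax|A [E [V V1 VE] EA]].
  exists [set yz | A (x * (yz.1^-1 * yz.2))].
    exists [set y | A (x * y)] => //.
    by apply: nbhs_mull; rewrite mulg1.
  by move=> y /xsectionP /=; rewrite mulVKg.
have /(nbhs_mull (a := x^-1)) : nbhs (x^-1 * x) V by rewrite mulVg.
by apply: filterS => y Vy; apply/EA/xsectionP/VE.
Qed.

Lemma right_nbhsE : nbhs = nbhs_ right_entourage.
Proof.
apply/funext => x; apply/seteqP; split=> [A Ax|A [E [V /nbhs1_inv V1 VE] EA]].
  exists [set yz | A ((yz.1 * yz.2^-1)^-1 * x)].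
    exists [set y | A (y^-1 * x)] => //.
    apply: (nbhs1_inv (V := [set y | A (y * x)])).
    by apply: nbhs_mulr; rewrite mul1g.
  by move=> y /xsectionP /=; rewrite invgM invgK mulgVK.
have /(nbhs_mulr (a := x^-1)) : nbhs (x * x^-1) [set z | V z^-1].
  by rewrite mulgV.
apply: filterS => y /= Vy; apply/EA/xsectionP/VE => /=.
by move: Vy; rewrite invgM invgK.
Qed.

End Uniformities.

(* Copies of G, as a topological space, carrying the left (resp. right)
   uniformity, so that the library's [unif_continuous] applies to both. *)
Definition left_uniform (G : topologicalGroupType) : Type := G.
Definition right_uniform (G : topologicalGroupType) : Type := G.

HB.instance Definition _ (G : topologicalGroupType) :=
  Topological.copy (left_uniform G) G.
HB.instance Definition _ (G : topologicalGroupType) :=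
  Nbhs_isUniform_mixin.Build (left_uniform G)
    (left_entourage_filter G) (@left_entourage_diagonal G)
    (@left_entourage_inv G) (@left_entourage_split G) (left_nbhsE G).

HB.instance Definition _ (G : topologicalGroupType) :=
  Topological.copy (right_uniform G) G.
HB.instance Definition _ (G : topologicalGroupType) :=
  Nbhs_isUniform_mixin.Build (right_uniform G)
    (right_entourage_filter G) (@right_entourage_diagonal G)
    (@right_entourage_inv G) (@right_entourage_split G) (right_nbhsE G).

Definition SIN (G : topologicalGroupType) : Prop :=
  @entourage (left_uniform G) = @entourage (right_uniform G)
    :> set_system (G * G).

Definition FSIN (R : realType) (G : topologicalGroupType) : Prop :=
  forall f : G -> R, bounded_fun f ->
    unif_continuous (f : left_uniform G -> R) ->
    unif_continuous (f : right_uniform G -> R).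

Definition periodic_group (G : groupType) : Prop :=
  forall x : G, exists2 n, (0 < n)%N & x ^+ n = 1.

Definition baire_space (T : topologicalType) : Prop :=
  forall F : (set T)^nat,
    (forall i, open (F i) /\ dense (F i)) -> dense (\bigcap_i F i).

(* Main.v *)
Require Import Defs.
From mathcomp Require Import all_boot all_order all_algebra.
From mathcomp Require Import all_classical all_reals all_analysis.
From mathcomp Require wochoice.

(* Urysohn's lemma for the left uniformity turns FSIN into the following: for
   every S and every neighborhood V of 1 there is a neighborhood U of 1 with
   US <= SV.  Hence, if A is uniformly discrete for the left uniformity, each
   small u acts on A by the permutation sending a to the b in A with ua in bV,
   and every subset of A is invariant under all small u.

   If the permutations also preserved a well-order < of A, they would be trivial
   and conjugates of small u by elements of A would be small.  So one encodes <
   into a subset of G.  The pairs (a, b) are sorted by the double coset VfV of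
   a^-1 b, with f ranging over a set F such that the sets VfV are disjoint; such
   an F satisfies f^-1 U f <= V for some U, again by US <= SV.  Fix a finer
   discrete set K and an injection phi of F into a tiny neighborhood, with image
   again separated by double cosets.  The code of < is the set of the k phi(f),
   where k in K is near a, kf is near b, and a < b: from k phi(f) one reads
   off k because phi(f) is tiny, and then f.  Since cardinals are well-founded,
   there is a neighborhood W of 1 such that phi exists for all F <= W.  This
   makes every neighborhood Y of 1 with Y^-1 Y <= W thin: for every N there is U
   with y^-1 U y <= N for all y in Y.

   Finally G = YBY for some B with disjoint YbY, and B is thin like F above, so
   G is thin, that is, SIN. *)

Set Implicit Arguments.
Unset Strict Implicit.
Unset Printing Implicit Defensive.

Import numFieldNormedType.Exports.

Local Open Scope classical_set_scope.
Local Open Scope group_scope.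

(** * Zorn's lemma, comparison of cardinals, well-orders *)

Lemma maximal_independent (T : Type) (X : set T) (r : T -> T -> Prop) :
  (forall x, r x x) -> (forall x y, r x y -> r y x) ->
  exists M : set T, [/\ M `<=` X,
    forall x y, M x -> M y -> r x y -> x = y &
    forall x, X x -> exists2 m, M m & r m x].
Proof.
move=> rr rC.
pose P (A : set T) := A `<=` X /\ forall x y, A x -> A y -> r x y -> x = y.
have [F FP Ftot|M [[MX Mi] Mmax]] := @Zorn_bigcup T P.
  split=> [x [A FA Ax]|x y [A FA Ax] [B FB By]]; first exact: (FP _ FA).1.
  have [AB|BA] := Ftot _ _ FA FB.
    by apply: (FP _ FB).2 => //; exact: AB.
  by apply: (FP _ FA).2 => //; exact: BA.
exists M; split=> // x Xx; apply: contrapT => nx.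
have Mx : ~ M x by move=> Mx; apply: nx; exists x.
apply: (Mmax (M `|` [set x])).
  by split=> [y My|sub]; [left | apply: Mx; apply: sub; right].
split=> [y [/MX//|->//]|y z [My|->] [Mz|->]] //; first exact: Mi.
  by move=> ryx; case: nx; exists y.
by move=> rxz; case: nx; exists z => //; exact: rC.
Qed.

(** Take a maximal family of choice functions that pairwise differ at every index. At some [i] its
    values exhaust [F i]: otherwise a missed value at each index would give one more function.
    Following each function from [i] to [j] injects [F i] into [F j]. *)
Lemma least_cardinal (I T : Type) (F : I -> set T) : inhabited I ->
  exists i, forall j, exists phi : T -> T,
    (forall x, F i x -> F j (phi x)) /\
    (forall x y, F i x -> F i y -> phi x = phi y -> x = y).
Proof.
move=> [i0].
pose X : set (I -> T) := [set t | forall i, F i (t i)].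
pose r (s t : I -> T) := exists i, s i = t i.
have [||M [MX Mi Mmax]] := @maximal_independent _ X r.
- by move=> t; exists i0.
- by move=> s t [i st]; exists i.
have [i iM] : exists i, forall x, F i x -> exists2 m, M m & m i = x.
  apply: contrapT => /forallNP noti.
  have /choice[t tP] i : exists x, F i x /\ forall m, M m -> m i <> x.
    have /existsNP[x /not_implyP[Fx nx]] := noti i.
    by exists x; split=> // m Mm mx; apply: nx; exists m.
  have [m Mm [i mt]] := Mmax t (fun i => (tP i).1).
  exact: (tP i).2 mt.
exists i => j.
have /choice[psi psiP] x : exists m, F i x -> M m /\ m i = x.
  have [Fx|nFx] := pselect (F i x); first by have [m] := iM x Fx; exists m.
  by exists (fun=> x).
exists (fun x => psi x j); split=> [x|x y Fx Fy pxy].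
  by move=> /psiP[/MX Xm _]; exact: Xm.
have [Mx <-] := psiP x Fx; have [My <-] := psiP y Fy.
by rewrite (Mi (psi x) (psi y)) //; exists j.
Qed.

Lemma well_founded_tournament (T : eqType) : exists lt : T -> T -> Prop,
  (forall a b, lt a b -> ~ lt b a) /\
  (forall A : set T, A !=set0 ->
     exists2 a, A a & forall b, A b -> b <> a -> lt a b).
Proof.
have [R Rwo] := wochoice.well_ordering_principle T.
exists (fun a b => a <> b /\ R a b); split=> [a b [ab Rab] [_ Rba]|A [x Ax]].
  have Rxx c : R c c.
    have [z [[/eqP -> zmin] _]] : exists! z, wochoice.minimum_of R (pred1 c) z.
      by apply: Rwo; exists c; rewrite inE.
    by apply: zmin; rewrite inE.
  (* Uniqueness of the minimum of {a, b} gives antisymmetry. *)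
  have [z [_ zu]] : exists! z, wochoice.minimum_of R (pred2 a b) z.
    by apply: Rwo; exists a; rewrite !inE eqxx.
  apply: ab; rewrite -(zu a) ?(zu b) //; split; rewrite ?inE ?eqxx ?orbT //.
    by move=> c; rewrite !inE => /orP[]/eqP->.
  by move=> c; rewrite !inE => /orP[]/eqP->.
have [a [[Aa amin] _]] : exists! z, wochoice.minimum_of R (fun x => x \in A) z.
  by apply: Rwo; exists x; apply: mem_set.
exists a => [|b Ab ba]; first exact: set_mem.
by split; [exact: nesym | apply: amin; apply: mem_set].
Qed.

(** * Uniformly continuous separation and neutrality *)

Section unif_urysohn.
Import Order.TTheory GRing.Theory Num.Theory.
Local Open Scope ring_scope.

(** For nonempty [A], [f] is the distance to [A], truncated at [eps], in a pseudometric whose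
    uniformity contains [E] and is coarser than that of [T]. *)
Lemma unif_continuous_separation (R : realType) (T : uniformType) (A : set T)
    (E : set (T * T)) : entourage E ->
  exists (f : T -> R) (eps : R),
    [/\ 0 < eps, bounded_fun f, unif_continuous f, forall x, A x -> f x = 0 &
        forall x, f x < eps -> exists2 a, A a & E (a, x)].
Proof.
move=> entE; pose T' : pseudoMetricType R := gauge.type entE.
have [eps epsE] : exists eps : {posnum R},
    forall x y : T', ball x eps%:num y -> E (x, y).
  have : @entourage T' (E `&` E^-1%relation) by exists 0%N.
  rewrite -entourage_ballE; case=> _/posnumP[eps] epsE; exists eps.
  by move=> x y bxy; have [] := epsE (x, y) bxy.
have [->|/set0P[a Aa]] := eqVneq A set0.
  exists (fun=> 1), 1; split => //; last by move=> x; rewrite ltxx.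
  - by exists 1; split => // M M1 x _ /=; rewrite normr1 ltW.
  - move=> B /entourage_refl B1.
    by apply: filterS (@filterT _ (@entourage T) _) => -[x y] _; exact: B1.
have dfin x : @edist_inf R T' A x \is a fin_num.
  rewrite ge0_fin_numE ?edist_inf_ge0 //; apply: le_lt_trans.
    by apply: ereal_inf_lbound; exists a.
  rewrite -ge0_fin_numE ?edist_ge0 //; apply/edist_finP => /=; exists 2 => //.
  exact: countable_uniform.countable_uniform_bounded.
pose d (x : T) := fine (@edist_inf R T' A x).
have d0 x : 0 <= d x by rewrite fine_ge0 // edist_inf_ge0.
have dlip (x y : T') r : 0 < r -> ball x r y -> d x <= d y + r.
  move=> r0 bxy; rewrite -lee_fin EFinD !fineK // addeC.
  apply: le_trans; first exact: (@edist_inf_triangle R T' A x y).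
  rewrite leeD2r //.
  exact: (@edist_fin R T' r (x, y)).
pose f x := Num.min (d x) eps%:num.
have flip (x y : T') r : 0 < r -> ball x r y -> f x <= f y + r.
  move=> r0 bxy; rewrite /f addr_minl le_min !ge_min.
  by rewrite (dlip _ _ _ r0 bxy) /= lerDl (ltW r0) orbT.
exists f, eps%:num; split => //.
- exists eps%:num; split => // M epsM x _ /=.
  rewrite ger0_norm ?le_min ?d0 ?andbT ?ge0 //.
  by rewrite ge_min (ltW epsM) orbT.
- move=> B; rewrite -entourage_ballE => -[_/posnumP[r] rB].
  suff : @entourage T' [set xy | B (f xy.1, f xy.2)] by exact: gauge.gauge_ent.
  rewrite -entourage_ballE; exists (r%:num / 2) => //= -[x y] /= bxy.
  apply: rB => /=; rewrite /ball /= (@le_lt_trans _ _ (r%:num / 2)) //.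
    rewrite ler_distl lerBlDr !flip //; exact: ball_sym.
  by rewrite ltr_pdivrMr // ltr_pMr // ltr1n.
- by move=> x Ax; rewrite /f /d edist_inf0 // fine0 min_l.
- move=> x; rewrite /f gt_min ltxx orbF.
  rewrite -lte_fin fineK // => /ereal_inf_lt [_ [z Az <-]] xz.
  by exists z => //; apply: epsE; exact/ball_sym/(@edist_lt_ball R T' _ (x, z)).
Qed.

End unif_urysohn.

Definition neutral_subsets (G : topologicalGroupType) := forall S V : set G,
  nbhs (1 : G) V -> exists2 U : set G, nbhs (1 : G) U &
    forall u s, U u -> S s -> exists2 t, S t & V (t^-1 * (u * s)).

(** The function separating [S] from the complement of SV is right uniformly continuous, and us is
    right-close to s because us s^-1 = u. *)
Lemma FSIN_neutral (R : realType) (G : topologicalGroupType) :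
  FSIN R G -> neutral_subsets G.
Proof.
move=> fsin S V V1.
have entE : @entourage (left_uniform G) [set xy | V (xy.1^-1 * xy.2)].
  by exists V.
have [f [eps [eps0 bf ucf f0 fE]]] :=
  @unif_continuous_separation R (left_uniform G) S _ entE.
have epsB : entourage [set xy : R * R | ball xy.1 eps xy.2].
  by rewrite -entourage_ballE; exists eps.
have [U U1 UE] := fsin f bf ucf _ epsB.
exists U => // u s Uu Ss.
have : ball (f (u * s)) eps (f s).
  by apply: (UE (u * s, s)) => /=; rewrite mulgK.
rewrite /ball /= (f0 s) // GRing.subr0 => /Num.Theory.ltr_normlW; exact: fE.
Qed.

(** * Products of neighborhoods, discrete sets, thin sets *)

Section Neighborhoods.
Variable G : topologicalGroupType.
Implicit Types (A F N S U V W Y : set G) (x y : G).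

Definition groupE :=
  (@invgM G, @invgK G, @invg1 G, @mulgA G, @mulg1 G, @mul1g G, @mulVg G,
   @mulgV G, @mulgK G, @mulgVK G).

Definition symmetric_nbhs V := nbhs (1 : G) V /\ forall x, V x -> V x^-1.

Lemma symmetric_nbhsI V W :
  symmetric_nbhs V -> symmetric_nbhs W -> symmetric_nbhs (V `&` W).
Proof.
move=> [V1 Vs] [W1 Ws]; split; first exact: filterI.
by move=> x [/Vs ? /Ws].
Qed.

Lemma symmetric_nbhs_sub N : nbhs (1 : G) N ->
  exists2 V, symmetric_nbhs V & V `<=` N.
Proof.
move=> N1; exists (N `&` [set x | N x^-1]) => [|x []//].
split; first exact/filterI/nbhs1_inv.
by move=> x /= [Nx NVx]; rewrite invgK.
Qed.

Fixpoint setpow V n : set G :=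
  if n is n'.+1 then
    [set x | exists2 a, setpow V n' a & exists2 b, V b & x = a * b]
  else [set 1].

Lemma setpow1 V x : V x -> setpow V 1 x.
Proof. by move=> Vx; exists 1 => //; exists x; rewrite ?mul1g. Qed.

Lemma setpowD V m n x y :
  setpow V m x -> setpow V n y -> setpow V (m + n) (x * y).
Proof.
move=> Vx; elim: n y => [|n IH] y /=; first by move->; rewrite addn0 mulg1.
move=> [a /IH Va [b Vb ->]]; rewrite addnS; exists (x * a) => //.
by exists b; rewrite ?mulgA.
Qed.

Lemma setpowV V n x : symmetric_nbhs V -> setpow V n x -> setpow V n x^-1.
Proof.
move=> [_ Vs]; elim: n x => [|n IH] x /=; first by move->; rewrite invg1.
move=> [a /IH Va [b /Vs Vb ->]]; rewrite invgM.
exact: (setpowD (setpow1 Vb) Va).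
Qed.

Lemma setpow_mono V W n : V `<=` W -> setpow V n `<=` setpow W n.
Proof.
move=> VW; elim: n => //= n IH x [a /IH Wa [b /VW Wb ->]].
by exists a => //; exists b.
Qed.

Lemma setpow_leq V m n : V 1 -> (m <= n)%N -> setpow V m `<=` setpow V n.
Proof.
move=> V1 /subnK <- x Vx; elim: (n - m)%N => [//|k IH].
by rewrite addSn; exists x => //; exists 1; rewrite ?mulg1.
Qed.

Lemma setpow_small N n : nbhs (1 : G) N ->
  exists2 V, symmetric_nbhs V & setpow V n `<=` N.
Proof.
elim: n N => [|n IH] N N1.
  exists setT => [|x ->]; last exact: nbhs_singleton.
  by split=> //; exact: filterT.
have [W W1 WN] := nbhs1_mul N1.
have [V Vs VW] := IH _ W1; have [V' V's V'W] := symmetric_nbhs_sub W1.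
exists (V `&` V'); first exact: symmetric_nbhsI.
move=> x [a /(setpow_mono (@subIsetl _ _ _))/VW Wa [b [_ /V'W Wb] ->]].
exact: WN.
Qed.

Definition left_discrete V A := forall x y, A x -> A y -> V (x^-1 * y) -> x = y.

Lemma maximal_left_discrete V Y : symmetric_nbhs V -> exists A,
  [/\ A `<=` Y, left_discrete V A &
      forall y, Y y -> exists2 a, A a & V (a^-1 * y)].
Proof.
move=> [V1 Vs]; apply: maximal_independent => [x|x y].
  by rewrite mulVg; exact: nbhs_singleton.
by move=> /Vs; rewrite invgM invgK.
Qed.

Definition bidiscrete V A :=
  forall x y v w, A x -> A y -> V v -> V w -> x = v * y * w -> x = y.

Lemma maximal_bidiscrete V Y : symmetric_nbhs V -> exists A,
  [/\ A `<=` Y, bidiscrete V A &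
      forall y, Y y -> exists2 a, A a &
        exists v w, [/\ V v, V w & y = v * a * w]].
Proof.
move=> [V1 Vs]; pose r x y := exists v w, [/\ V v, V w & y = v * x * w].
have [x|x y|A [AY Ar Amax]] := @maximal_independent G Y r.
- by exists 1, 1; rewrite mul1g mulg1; split=> //; exact: nbhs_singleton.
- move=> [v [w [Vv Vw ->]]]; exists v^-1, w^-1; split; [exact: Vs|exact: Vs|].
  by rewrite !groupE.
exists A; split=> // x y v w Ax Ay Vv Vw xE.
by apply: esym; apply: Ar => //; exists v, w.
Qed.

Definition thin Y := forall N, nbhs (1 : G) N -> exists2 U, nbhs (1 : G) U &
  forall u y, U u -> Y y -> N (y^-1 * (u * y)).

(** If ua = bv with b in [A] and u, v small, then a = u^-1 b v forces a = b, so a^-1 u a = v is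
    small. *)
Lemma bidiscrete_thin V A :
  neutral_subsets G -> nbhs (1 : G) V -> bidiscrete V A -> thin A.
Proof.
move=> neutral V1 Ad N N1.
have [U U1 UA] := neutral A (N `&` V) (filterI N1 V1).
exists (U `&` [set x | V x^-1]); first exact/filterI/nbhs1_inv.
move=> u a [Uu Vu] Aa; have [b Ab [Nb Vb]] := UA _ _ Uu Aa.
by rewrite {1}(Ad a b u^-1 (b^-1 * (u * a))) // !groupE.
Qed.

Definition has_bidiscrete_copy F N := exists V (phi : G -> G),
  [/\ nbhs (1 : G) V, forall f, F f -> N (phi f) &
      forall f g v w, F f -> F g -> V v -> V w ->
        phi f = v * phi g * w -> f = g].

(* [W] is chosen so that a bidiscrete subset of [W] has the least possible
   cardinality; smaller neighborhoods then contain sets at least as large. *)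
Lemma small_bidiscrete_copies : exists2 W, nbhs (1 : G) W &
  forall V F, nbhs (1 : G) V -> F `<=` W -> bidiscrete V F ->
  forall N, nbhs (1 : G) N -> has_bidiscrete_copy F N.
Proof.
apply: contrapT => noW.
have /choice[t tP] (i : {W : set G | nbhs (1 : G) W}) :
    exists t : set G * set G * set G,
      [/\ nbhs (1 : G) t.1.1, t.1.2 `<=` sval i, bidiscrete t.1.1 t.1.2,
          nbhs (1 : G) t.2 & ~ has_bidiscrete_copy t.1.2 t.2].
  apply: contrapT => not; apply: noW; exists (sval i) => [|V F V1 FW Fd N N1].
    exact: svalP.
  by apply: contrapT => nc; apply: not; exists (V, F, N).
have [|i imin] := @least_cardinal _ _ (fun i => (t i).1.2).
  by split; exists setT; exact: filterT.
have [_ _ _ N1 nc] := tP i.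
pose j : {W : set G | nbhs (1 : G) W} := exist _ _ N1.
have [V1 FN Fd _ _] := tP j; have [phi [phiF phi_inj]] := imin j.
apply: nc; exists (t j).1.1, phi; split=> [//|f /phiF/FN//|].
move=> f g v w Ff Fg Vv Vw fg; apply: phi_inj => //.
by apply: (Fd _ _ v w) => //; exact: phiF.
Qed.

Lemma thin_nbhs_SIN Y :
  neutral_subsets G -> nbhs (1 : G) Y -> thin Y -> SIN G.
Proof.
move=> neutral Y1 Ythin.
have [W Ws WY] := symmetric_nbhs_sub Y1.
have Wthin : thin W.
  move=> N /Ythin[U U1 UY]; exists U => // u y Uu /WY; exact: UY.
have [A [_ Ad Amax]] := maximal_bidiscrete setT Ws.
have Athin := bidiscrete_thin neutral Ws.1 Ad.
have Gthin N : nbhs (1 : G) N -> exists2 U, nbhs (1 : G) U &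
    forall u g, U u -> N (g^-1 * (u * g)).
  move=> /Wthin[N' /Athin[N'' /Wthin[U U1 UN''] N''N'] N'N].
  exists U => // u g Uu; have [a Aa [v [w [Wv Ww ->]]]] := Amax g I.
  have := N'N _ w (N''N' _ _ (UN'' _ _ Uu Wv) Aa) Ww.
  by rewrite !groupE.
(* Both inclusions rest on x^-1 y = y^-1 (x y^-1)^-1 y, which makes x^-1 y conjugate to the inverse
   of x y^-1. *)
apply/seteqP; split=> E [V V1 VE].
  have [U /nbhs1_inv U1 UV] := Gthin _ V1; exists [set x | U x^-1] => //.
  move=> [x y] /= Uxy; apply: VE => /=.
  by have := UV _ y Uxy; rewrite !groupE.
have [U /nbhs1_inv U1 UV] := Gthin _ V1; exists [set x | U x^-1] => //.
move=> [x y] /= Uxy; apply: VE => /=.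
by have := UV _ x^-1 Uxy; rewrite !groupE.
Qed.

(** * Coding a well-order by a subset of the group *)

Lemma neutral_thin_nbhs : neutral_subsets G ->
  exists2 Y, nbhs (1 : G) Y & thin Y.
Proof.
move=> neutral; have [W W1 copies] := small_bidiscrete_copies.
have [Y Ys YW] := setpow_small 2 W1.
exists Y => [|N N1]; first exact: Ys.1.
(* The exponents count factors: y^-1 u y is finally split into three, and points of [A] are compared
   through six in [lt_stable]. *)
have [N' N's N'N] := setpow_small 3 N1.
have [V Vs VN'] := setpow_small 6 N's.1.
have [A [AY Ad Amax]] := maximal_left_discrete Y N's.
have [F [FW Fd Fmax]] := maximal_bidiscrete W Vs.
(* Conjugation by [F] keeps [V2] inside [V], so a small error in k remains small in kf. *)
have [V2 V2s [V2V V2F]] : exists2 V2, symmetric_nbhs V2 &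
    V2 `<=` V /\ forall v f, V2 v -> F f -> V (f^-1 * (v * f)).
  have [U U1 UF] := bidiscrete_thin neutral Vs.1 Fd Vs.1.
  have [V2 V2s V2U] := symmetric_nbhs_sub (filterI U1 Vs.1).
  by exists V2 => //; split=> [v /V2U[]//|v f /V2U[Uv _]]; exact: UF.
have [K [_ Kd Kmax]] := maximal_left_discrete setT V2s.
have [V3 V3s V3V2] := setpow_small 4 V2s.1.
have [V4 [phi [V41 phiV3 phi_inj]]] := copies _ _ Vs.1 FW Fd _ V3s.1.
have [E Es Esub] := symmetric_nbhs_sub
  (filterI (filterI V41 V3s.1) (filterI V2s.1 N's.1)).
have EV4 x : E x -> V4 x by move=> /Esub[[]].
have EV3 x : E x -> V3 x by move=> /Esub[[]].
have EV2 x : E x -> V2 x by move=> /Esub[_ []].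
have EN' x : E x -> N' x by move=> /Esub[_ []].
have EV x : E x -> V x by move=> /EV2/V2V.
have [lt [lt_asym lt_min]] := well_founded_tournament G.
(* As [A] is discrete, [k] and [f] determine [a] and [b]. *)
pose up k f := exists a b, [/\ A a, A b, setpow V 2 (a^-1 * k),
  setpow V 2 (b^-1 * (k * f)) & lt a b].
pose S : set G := [set x | exists k f, [/\ K k, F f, up k f & x = k * phi f]].
have [UA UA1 UAP] := neutral A E Es.1.
have [UK UK1 UKP] := neutral K E Es.1.
have [US US1 USP] := neutral S E Es.1.
have [U Us Usub] := symmetric_nbhs_sub (filterI UA1 (filterI UK1 US1)).
have {}UAP u a : U u -> A a -> exists2 b, A b & E (b^-1 * (u * a)).
  by move=> /Usub[/UAP UAu _]; exact: UAu.
(* u moves the code of (k, f) near the code of some (m, g). The product of four factors of [V3]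
   shows m = l by discreteness of [K]; then [phi f] and [phi g] differ by factors in [V4], so f =
   g. *)
have up_stable u k f : U u -> K k -> F f -> up k f ->
    exists2 l, up l f & E (l^-1 * (u * k)).
  move=> /Usub[_ [/UKP UKu /USP USu]] Kk Ff kf.
  have [l Kl El] := UKu k Kk.
  have [|_ [m [g [Km Fg mg ->]]] Em] := USu (k * phi f); first by exists k, f.
  have lm : m = l.
    apply: Kd => //; apply: V3V2.
    have -> : m^-1 * l = phi g * ((m * phi g)^-1 * (u * (k * phi f))) *
        (phi f)^-1 * (l^-1 * (u * k))^-1 by rewrite !groupE.
    have p1 x : V3 x -> setpow V3 1 x by exact: setpow1.
    apply: (@setpowD V3 3 1); last exact/p1/V3s.2/EV3.
    apply: (@setpowD V3 2 1); last exact/p1/V3s.2/phiV3.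
    by apply: (@setpowD V3 1 1); apply: p1; [exact: phiV3|exact: EV3].
  exists l => //; suff -> : f = g by rewrite -lm.
  apply: (phi_inj f g (l^-1 * (u * k))^-1
    ((m * phi g)^-1 * (u * (k * phi f)))) => //.
  - exact/EV4/Es.2.
  - exact: EV4.
  - by rewrite lm !groupE.
have link a b : A a -> A b -> exists k f,
    [/\ K k, F f, setpow V 2 (a^-1 * k) & setpow V 2 (b^-1 * (k * f))].
  move=> Aa Ab; have [|f Ff [v [w [Vv Vw abE]]]] := Fmax (a^-1 * b).
    by apply: YW; apply: (@setpowD Y 1 1); apply: setpow1;
      [apply: Ys.2|]; apply: AY.
  have [k Kk /V2s.2 Vk] := Kmax (a * v) I; exists k, f; split=> //.
    have -> : a^-1 * k = v * (k^-1 * (a * v))^-1 by rewrite !groupE.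
    by apply: (@setpowD V 1 1); apply: setpow1 => //; exact: V2V.
  have -> : b^-1 * (k * f) = w^-1 * (f^-1 * ((k^-1 * (a * v))^-1 * f)).
    by rewrite -(mulVKg a b) abE !groupE.
  by apply: (@setpowD V 1 1); apply: setpow1; [exact: Vs.2|exact: V2F].
(* The pair (k, f) of (a, b) is moved to a pair (l, f) of some c < d, and discreteness of [A] gives
   c = a' and d = b'. *)
have lt_stable u a b a' b' : U u -> A a -> A b -> A a' -> A b' -> lt a b ->
    E (a'^-1 * (u * a)) -> E (b'^-1 * (u * b)) -> lt a' b'.
  move=> Uu Aa Ab Aa' Ab' ab Ea Eb.
  have [k [f [Kk Ff ak bkf]]] := link a b Aa Ab.
  have [|l [c [d [Ac Ad' cl dlf cd]]] El] := up_stable u k f Uu Kk Ff.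
    by exists a, b.
  have -> : a' = c.
    apply/esym/Ad => //; apply: VN'.
    have -> : c^-1 * a' = (c^-1 * l) * (l^-1 * (u * k)) * (a^-1 * k)^-1 *
        (a'^-1 * (u * a))^-1 by rewrite !groupE.
    apply: (@setpowD V 5 1); last exact/setpow1/EV/Es.2.
    apply: (@setpowD V 3 2); last exact: setpowV.
    by apply: (@setpowD V 2 1) => //; exact/setpow1/EV.
  suff -> : b' = d by [].
  apply/esym/Ad => //; apply: VN'.
  have -> : d^-1 * b' = (d^-1 * (l * f)) * (f^-1 * ((l^-1 * (u * k)) * f)) *
      (b^-1 * (k * f))^-1 * (b'^-1 * (u * b))^-1 by rewrite !groupE.
  apply: (@setpowD V 5 1); last exact/setpow1/EV/Es.2.
  apply: (@setpowD V 3 2); last exact: setpowV.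
  by apply: (@setpowD V 2 1) => //; apply/setpow1/V2F => //; exact: EV2.
pose moved : set G := [set a | A a /\
  exists u b, [/\ U u, A b, b <> a & E (b^-1 * (u * a))]].
have [moved0|/set0P/lt_min[a [Aa [u [b [Uu Ab ba Eab]]]] amin]] :=
    eqVneq moved set0.
  exists U => [|u y Uu Yy]; first exact: Us.1.
  have [a Aa Na] := Amax y Yy; have [b Ab Eb] := UAP u a Uu Aa.
  have ba : b = a.
    apply: contrapT => ba; suff : moved a by rewrite moved0.
    by split=> //; exists u, b.
  rewrite {}ba in Eb; apply: N'N.
  have -> : y^-1 * (u * y) = (a^-1 * y)^-1 * (a^-1 * (u * a)) * (a^-1 * y).
    by rewrite !groupE.
  apply: (@setpowD N' 2 1); last exact: setpow1.
  apply: (@setpowD N' 1 1); apply: setpow1; first exact: N's.2.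
  exact: EN'.
(* For the least moved a, u sends a to b and c to a. Minimality gives a < b and a < c, but u^-1
   sends (a, b) to (c, a), so stability gives c < a. *)
have Uu' := Us.2 _ Uu.
have Eba : E (a^-1 * (u^-1 * b)) by have := Es.2 _ Eab; rewrite !groupE.
have ab : lt a b.
  by apply: amin => //; split=> //; exists u^-1, a; split=> //; exact: nesym.
have [c Ac Eca] := UAP u^-1 a Uu' Aa.
have Eac : E (a^-1 * (u * c)) by have := Es.2 _ Eca; rewrite !groupE.
have ca : c <> a.
  move=> ca; rewrite ca in Eac; apply: ba; apply: Ad => //.
  apply: VN'.
  have -> : b^-1 * a = b^-1 * (u * a) * (a^-1 * (u * a))^-1 by rewrite !groupE.
  apply: (@setpow_leq V 2 6) => //; first exact: nbhs_singleton Vs.1.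
  by apply: (@setpowD V 1 1); apply/setpow1/EV => //; exact: Es.2.
apply: False_ind; apply: (lt_asym c a); first exact: (lt_stable u^-1 a b c a).
by apply: amin => //; split=> //; exists u, a; split=> //; exact: nesym.
Qed.

End Neighborhoods.

Theorem corollary3p9 (R : realType) (G : topologicalGroupType) :
  hausdorff_space G -> FSIN R G -> periodic_group G -> baire_space G -> SIN G.
Proof.
move=> _ /FSIN_neutral neutral _ _.
have [Y Y1 Ythin] := neutral_thin_nbhs neutral.
exact: (thin_nbhs_SIN neutral Y1 Ythin).
Qed.
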